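(* As $\theta \to 0$ (with $\theta > 0$), $$\lambda_\theta = 1 - (\ln 2)\,\theta + O(\theta^2).$$
   Context: For $\theta > 0$, the generalized Golomb--Dickman constant is $\lambda_\theta := \lim_{n\to\infty} \mathbb{E}_n^{\theta}[L_n]/n$, where $L_n$ is the length of the longest cycle of a random permutation $\sigma$ in the symmetric group $S_n$ on $\{1,\dots,n\}$ distributed according to the Ewens measure $\mathbb{P}_n^{\theta}(\sigma) = \theta^{C(\sigma)}/\bigl(\theta(\theta+1)\cdots(\theta+n-1)\bigr)$, $C(\sigma)$ is the total number of cycles of $\sigma$ (fixed points included), and $\mathbb{E}_n^{\theta}$ is expectation with respect to $\mathbb{P}_n^{\theta}$. This limit exists and has the integral representation $$\lambda_\theta = \int_0^\infty \exp\bigl[-t - \theta E_1(t)\bigr]\,dt, \qquad E_1(x) = \int_x^\infty \frac{e^{-t}}{t}\,dt \quad (x>0),$$ which may be taken as the definition of $\lambda_\theta$ here. *)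

(* Defs.v *)
From HB Require Import structures.
From mathcomp Require Import all_boot all_order all_algebra.
From mathcomp Require Import all_classical all_reals all_analysis.

Set Implicit Arguments.
Unset Strict Implicit.
Unset Printing Implicit Defensive.

Import Order.TTheory GRing.Theory Num.Theory.
Import numFieldNormedType.Exports.

Local Open Scope classical_set_scope.
Local Open Scope ring_scope.

(* Meaningful for [0 < x] only: for [x <= 0] the integral diverges and the
   real-valued integral is a junk value. *)
Definition expint1 (R : realType) (x : R) : R :=
  \int[lebesgue_measure]_(t in `]x, +oo[) (expR (- t) / t).

(* The limit of E_n[L_n] / n, where L_n is the length of the longest cycle of
   an Ewens([theta])-distributed permutation of n points, in its classical
   integral form, taken here as the definition. *)
Definition golomb_dickman (R : realType) (theta : R) : R :=
  \int[lebesgue_measure]_(t in `]0, +oo[) expR (- t - theta * expint1 t).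

(* Main.v *)
Require Import Defs.
From mathcomp Require Import all_boot all_order all_algebra.
From mathcomp Require Import all_classical all_reals all_analysis.
From mathcomp Require Import measurable_realfun.
From mathcomp Require Import lra ring.

Set Implicit Arguments.
Unset Strict Implicit.
Unset Printing Implicit Defensive.

Import Order.TTheory GRing.Theory Num.Theory.
Import numFieldNormedType.Exports.

Local Open Scope classical_set_scope.
Local Open Scope ring_scope.

(** Write [E] for [expint1] and [f s = exp (- s) / s] for its integrand.
    Integrating the elementary bounds [1 - y <= exp (- y) <= 1 - y + y ^ 2],
    valid for [y >= 0], at [y = theta * E t] against the weight [exp (- t)]
    squeezes the constant:
      [1 - theta * I1 <= golomb_dickman theta]
      [golomb_dickman theta <= 1 - theta * I1 + theta ^ 2 * I2]
    where [Ik] is the integral of [exp (- t) * E t ^ k] over the positive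
    half-line.  The proposition thus amounts to [I1 = ln 2] and [I2 < +oo].
    Both follow from one instance of Tonelli's theorem, the exchange of the
    order of integration over a triangle [c < t < s]
    ([integral_triangle_exchange]).

    - For [I1], the exchange carries the weight [exp (- t)] under the tail
      integral and leaves the Frullani integral of
      [(exp (- s) - exp (- 2 s)) / s], whose value is [ln 2]
      ([integral_expRN_expint1]; the Frullani integral [frullani_expR] is
      itself a Tonelli exchange).

    - For [I2], the exchange on [t < a < s] gives, without any
      differentiation, the identity [E t ^ 2 = 2 * \int_(s > t) f s * E s]
      ([sqr_expint1]).  A second exchange on [0 < t < s] turns [I2] into twice
      the integral of [f s * E s * (1 - exp (- s))]; as [1 - exp (- s) <= s]
      absorbs the singularity of [f] at [0], this is at most
      [2 * I1 = 2 * ln 2] ([integral_expRN_sqr_expint1]).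

    Hence the error is at most [2 * ln 2 * theta ^ 2] for every [theta > 0]
    ([golomb_dickman_expansion]). *)

(** * Exchanging the order of integration *)

Section tonelli.
Local Open Scope ereal_scope.

(** Patching [h] by [0] outside the rectangle reduces this to Tonelli's theorem
    on the whole product. *)
Lemma ge0_integral_exchange (d1 d2 : measure_display)
    (T1 : measurableType d1) (T2 : measurableType d2) (R : realType)
    (m1 : {sigma_finite_measure set T1 -> \bar R})
    (m2 : {sigma_finite_measure set T2 -> \bar R})
    (A : set T1) (B : set T2) (h : T1 * T2 -> \bar R) :
  measurable A -> measurable B -> measurable_fun (A `*` B) h ->
  (forall z, (A `*` B) z -> 0 <= h z) ->
  \int[m1]_(x in A) \int[m2]_(y in B) h (x, y) =
  \int[m2]_(y in B) \int[m1]_(x in A) h (x, y).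
Proof.
move=> mA mB mh h0.
have mAB := measurableX mA mB.
pose hAB : T1 * T2 -> \bar R := h \_ (A `*` B).
have hAB0 z : 0 <= hAB z by exact: erestrict_ge0.
have := fubini_tonelli (m1 := m1) (m2 := m2) hAB
  ((measurable_restrictT _ mAB).1 mh) hAB0.
have patchX x y : hAB (x, y) =
    if x \in A then ((fun y => h (x, y)) \_ B) y else 0.
  by rewrite /hAB !patchE in_setX; case: (x \in A); case: (y \in B).
under eq_integral => x _.
  rewrite (_ : \int[m2]_y _ =
    ((fun x => \int[m2]_(y in B) h (x, y)) \_ A) x); last first.
    under eq_integral do rewrite patchX.
    rewrite patchE; case: ifP => _; first by rewrite -integral_mkcond.
    by rewrite integral0.
  over.
under [X in _ = X -> _]eq_integral => y _.
  rewrite (_ : \int[m1]_x _ =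
    ((fun y => \int[m1]_(x in A) h (x, y)) \_ B) y); last first.
    rewrite patchE; case: ifPn => yB.
      rewrite [RHS]integral_mkcond; apply: eq_integral => x _.
      by rewrite patchX !patchE yB.
    rewrite integral0_eq// => x _.
    by rewrite patchX patchE (negbTE yB); case: ifP.
  over.
by rewrite -!integral_mkcond.
Qed.

Definition above_diag (R : realType) : set (R * R) := [set z | (z.1 < z.2)%R].
Arguments above_diag : clear implicits.

Lemma measurable_fun_above_diag (R : realType) (D : set R) (f g : R -> \bar R) :
  measurable D -> measurable_fun D f -> measurable_fun D g ->
  measurable_fun (D `*` D) ((fun z => g z.1 * f z.2) \_ (above_diag R)).
Proof.
move=> mD mf mg.
have mlt : measurable (above_diag R).
  rewrite -[above_diag R]setTI.
  exact: (measurable_fun_ltr (@measurable_fst _ _ R R)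
    (@measurable_snd _ _ R R) measurableT (Y := [set true])).
have mDD := measurableX mD mD.
apply: (measurable_restrict _ mlt mDD).1.
apply: (measurable_funS mDD (@subIsetl _ _ _)).
apply: emeasurable_funM.
- apply: (measurable_comp mD) => //; first by move=> _ [z [z1 z2] <-].
  exact: measurable_funTS.
- apply: (measurable_comp mD) => //; first by move=> _ [z [z1 z2] <-].
  exact: measurable_funTS.
Qed.

(** Cutting the integrand off along the diagonal trades a domain of integration
    that depends on [t] for the fixed half-line beyond [c], so that Tonelli's
    theorem for rectangles applies. *)
Lemma integral_above_diag (R : realType) (c t : R) (f : R -> \bar R) (k : \bar R) :
  measurable_fun `]c, +oo[ f -> (forall x, (c < x)%R -> 0 <= f x) ->
  (c < t)%R -> 0 <= k ->
  \int[lebesgue_measure]_(s in `]c, +oo[)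
    ((fun z : R * R => k * f z.2) \_ (above_diag R)) (t, s) =
  k * \int[lebesgue_measure]_(s in `]t, +oo[) f s.
Proof.
move=> mf f0 ct k0.
have tD : `]t, +oo[ `<=` `]c, +oo[ by apply: subset_itvr; rewrite bnd_simp ltW.
rewrite -ge0_integralZl//; last 2 first.
- by apply: measurable_funS mf.
- by move=> s; rewrite /= in_itv/= andbT => ts; rewrite f0// (lt_trans ct).
rewrite -(setIidr tD) integral_mkcondr; apply: eq_integral => s _.
rewrite !patchE; congr (if _ then _ else _).
by apply/idP/idP; rewrite !inE /above_diag /= in_itv/= andbT.
Qed.

(** The tail is a section integral of the integrand cut off along the diagonal,
    and Tonelli's theorem makes section integrals measurable. *)
Lemma measurable_fun_integral_tail (R : realType) (c : R) (f : R -> \bar R) :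
  measurable_fun `]c, +oo[ f -> (forall x, (c < x)%R -> 0 <= f x) ->
  measurable_fun `]c, +oo[
    (fun t => \int[lebesgue_measure]_(s in `]t, +oo[) f s).
Proof.
move=> mf f0.
pose D : set R := `]c, +oo[%classic.
have mD : measurable D by exact: measurable_itv.
pose h : R * R -> \bar R := (fun z => 1 * f z.2) \_ (above_diag R).
have mDD := measurableX mD mD.
have mh : measurable_fun setT (h \_ (D `*` D)).
  apply: (measurable_restrictT _ mDD).1.
  exact: (@measurable_fun_above_diag _ D _ (cst 1)).
have h0 z : 0 <= (h \_ (D `*` D)) z.
  apply: erestrict_ge0 => {}z [_]; rewrite /D /= in_itv/= andbT => cz.
  by rewrite /h patchE; case: ifP => // _; rewrite mul1e f0.
have := measurable_fun_fubini_tonelli_F (m2 := @lebesgue_measure R) _ mh h0.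
move=> /(measurable_funTS (D := D)); apply: eq_measurable_fun => t.
rewrite inE /D/= in_itv/= andbT => ct.
rewrite -[RHS]mul1e -(@integral_above_diag _ c)// [RHS]integral_mkcond.
apply: eq_integral => s _; rewrite /fubini_F/= [LHS]patchE [RHS]patchE in_setX.
by rewrite (_ : t \in D) //= inE /D /= in_itv/= ct.
Qed.

(** Both sides integrate [g t * f s] over the triangle [c < t < s]. *)
Lemma integral_triangle_exchange (R : realType) (c : R) (f g : R -> \bar R) :
  measurable_fun `]c, +oo[ f -> measurable_fun `]c, +oo[ g ->
  (forall x, (c < x)%R -> 0 <= f x) -> (forall x, (c < x)%R -> 0 <= g x) ->
  \int[lebesgue_measure]_(t in `]c, +oo[)
     (g t * \int[lebesgue_measure]_(s in `]t, +oo[) f s) =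
  \int[lebesgue_measure]_(s in `]c, +oo[)
     (f s * \int[lebesgue_measure]_(t in `]c, s[) g t).
Proof.
move=> mf mg f0 g0.
pose D : set R := `]c, +oo[%classic.
pose h : R * R -> \bar R := (fun z => g z.1 * f z.2) \_ (above_diag R).
have mD : measurable D by exact: measurable_itv.
have mh : measurable_fun (D `*` D) h by exact: measurable_fun_above_diag.
have h0 z : (D `*` D) z -> 0 <= h z.
  case: z => t s [/=]; rewrite /D /= !in_itv/= !andbT => ct cs.
  by rewrite /h patchE; case: ifP => // _; rewrite mule_ge0// ?f0 ?g0.
transitivity (\int[lebesgue_measure]_(t in D) \int[lebesgue_measure]_(s in D) h (t, s)).
  apply: eq_integral => t; rewrite inE /D /= in_itv/= andbT => ct.
  by rewrite -(@integral_above_diag _ c)// g0.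
rewrite ge0_integral_exchange//.
apply: eq_integral => s; rewrite inE /D /= in_itv/= andbT => cs.
have sD : `]c, s[ `<=` D by apply: subset_itvl; rewrite bnd_simp.
rewrite -ge0_integralZl ?f0//; last 2 first.
- by apply: measurable_funS mg.
- by move=> t; rewrite /= in_itv/= => /andP[ct _]; rewrite g0.
rewrite -(setIidr sD) integral_mkcondr; apply: eq_integral => t.
rewrite inE /D /= in_itv/= andbT => ct.
rewrite /h !patchE muleC; congr (if _ then _ else _).
by apply/idP/idP; rewrite !inE /above_diag /= in_itv/= ct.
Qed.

End tonelli.

(** * Exponential integrals and a Frullani integral *)

Lemma continuous_expRMN (R : realType) (s : R) :
  continuous (fun u : R => expR (- (s * u))).
Proof.
move=> u; apply: continuous_comp; last exact: continuous_expR.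
by apply: continuousN; apply: continuousM => //; exact: cst_continuous.
Qed.

Lemma measurable_expRMN (R : realType) (s : R) :
  measurable_fun setT (fun u : R => expR (- (s * u))).
Proof. by apply: continuous_measurable_fun; apply: continuous_expRMN. Qed.

Lemma is_derive_expRMN (R : realType) (s u : R) : s != 0 ->
  is_derive u 1 (fun u : R => - (expR (- (s * u)) / s)) (expR (- (s * u))).
Proof.
move=> s0.
have -> : (fun u : R => - (expR (- (s * u)) / s)) =
    (fun u : R => (- s^-1) * expR ((- s) * u)).
  by apply/funext => v; rewrite mulNr mulrC mulNr.
apply: is_derive_eq; rewrite /GRing.scale/= !mulNr.
by rewrite mulr1 !mulrN opprK mulrCA mulVf ?mulr1.
Qed.

Lemma integral_itv_expRMN (R : realType) (s a b : R) : s != 0 -> a < b ->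
  (\int[lebesgue_measure]_(u in `[a, b]) (expR (- (s * u)))%:E =
   ((expR (- (s * a)) - expR (- (s * b))) / s)%:E)%E.
Proof.
move=> s0 ab.
pose F (u : R) : R := - (expR (- (s * u)) / s).
have dF (u : R) : is_derive u 1 F (expR (- (s * u))) by exact: is_derive_expRMN.
have cF : continuous F.
  move=> u; apply: differentiable_continuous; apply/derivable1_diffP.
  exact: ex_derive.
rewrite (@continuous_FTC2 _ _ F)//.
- by rewrite -EFinB /F; congr EFin; ring.
- exact/continuous_subspaceT/continuous_expRMN.
- split.
  + by move=> u _; exact: ex_derive.
  + exact/cvg_at_right_filter/cF.
  + exact/cvg_at_left_filter/cF.
- by move=> u _; rewrite derive1E derive_val.
Qed.

Lemma integral_itvy_expRMN (R : realType) (s a : R) : 0 < s ->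
  (\int[lebesgue_measure]_(u in `]a, +oo[) (expR (- (s * u)))%:E =
   (expR (- (s * a)) / s)%:E)%E.
Proof.
move=> s0.
pose F (u : R) : R := - (expR (- (s * u)) / s).
have dF (u : R) : is_derive u 1 F (expR (- (s * u))).
  by apply: is_derive_expRMN; rewrite gt_eqF.
have cF : continuous F.
  move=> u; apply: differentiable_continuous; apply/derivable1_diffP.
  exact: ex_derive.
rewrite integral_itv_obnd_cbnd; last first.
  apply/measurable_EFinP; apply: measurable_funTS.
  apply: measurable_expRMN.
rewrite (@ge0_continuous_FTC2y _ _ F _ 0)//.
- by rewrite sub0e -EFinN /F opprK.
- apply: continuous_subspaceT; exact: continuous_expRMN.
- have cE : expR (- (s * x)) @[x --> +oo] --> (0 : R).
    apply: (@cvg_comp _ _ _ (fun x => s * x) (fun x => expR (- x)) _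
      (pinfty_nbhs R)); last exact: cvgr_expR.
    exact: gt0_cvgMry.
  have := cvgN (cvgM cE (cvg_cst (s^-1))).
  by rewrite mul0r oppr0; apply.
- exact/cvg_at_right_filter/cF.
- by move=> u _; rewrite derive1E derive_val.
Qed.

(** The integrand is the integral of [exp (- (s * u))] over [u] between [a]
    and [b]; integrating in [s] first leaves the integral of [1 / u]. *)
Lemma frullani_expR (R : realType) (a b : R) : 0 < a -> a < b ->
  (\int[lebesgue_measure]_(s in `]0%R, +oo[)
     ((expR (- (a * s)) - expR (- (b * s))) / s)%:E = (ln b - ln a)%:E)%E.
Proof.
move=> a0 ab.
transitivity (\int[@lebesgue_measure R]_(s in `]0%R, +oo[)
    \int[@lebesgue_measure R]_(u in `[a, b]) (expR (- (s * u)))%:E)%E.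
  apply: eq_integral => s; rewrite inE/= in_itv/= andbT => s0.
  by rewrite integral_itv_expRMN ?gt_eqF// ![_ * s]mulrC.
have mexp : measurable_fun (`](0 : R), +oo[ `*` `[a, b] : set (R * R))
    (fun z : R * R => (expR (- (z.1 * z.2)))%:E).
  apply/measurable_EFinP; apply: measurable_funTS; apply: measurableT_comp => //.
  by apply: measurableT_comp => //; apply: measurable_funM.
have := ge0_integral_exchange lebesgue_measure lebesgue_measure
  (measurable_itv _) (measurable_itv _) mexp (fun z _ => expR_ge0 _).
move=> /= ->.
transitivity (\int[@lebesgue_measure R]_(u in `[a, b]) (u^-1)%:E)%E.
  apply: eq_integral => u; rewrite inE/= in_itv/= => /andP[au _].
  under eq_integral do rewrite mulrC.
  by rewrite integral_itvy_expRMN ?(lt_le_trans a0)// mulr0 oppr0 expR0 mul1r.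
have cln (u : R) : 0 < u -> {for u, continuous (@ln R)} by exact: continuous_ln.
rewrite (@continuous_FTC2 _ _ (@ln R))// -?EFinB//.
- apply: continuous_in_subspaceT => u; rewrite inE/= in_itv/= => /andP[au _].
  by apply: inv_continuous; rewrite gt_eqF ?(lt_le_trans a0).
- split.
  + move=> u; rewrite in_itv/= => /andP[au _].
    by apply: ex_derive; apply: is_derive1_ln; exact: lt_trans au.
  + exact/cvg_at_right_filter/cln.
  + by apply/cvg_at_left_filter/cln; exact: lt_trans ab.
- move=> u; rewrite in_itv/= => /andP[au _].
  have ? := is_derive1_ln (lt_trans a0 au).
  by rewrite derive1E derive_val.
Qed.

(** * The exponential integral *)

Section expint1.
Variable R : realType.
Local Notation mu := (@lebesgue_measure R).
Local Notation E1 := (@expint1 R).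
Local Notation f := (fun s : R => expR (- s) / s).
Local Notation D := (`]0%R, +oo[%classic : set R).

Lemma itv0yP (t : R) : D t <-> 0 < t.
Proof. by rewrite /= in_itv/= andbT. Qed.

Lemma measurable_expRN (A : set R) : measurable_fun A (fun t : R => expR (- t)).
Proof. by apply: measurable_funTS; apply: measurableT_comp. Qed.

Lemma measurable_expint1_integrand : measurable_fun D f.
Proof.
apply: measurable_funM; first exact: measurable_expRN.
apply: open_continuous_measurable_fun; first exact: interval_open.
by move=> x; rewrite inE => /itv0yP x0; apply: inv_continuous; rewrite gt_eqF.
Qed.

Lemma expint1_integrand_ge0 (s : R) : 0 < s -> 0 <= f s.
Proof. by move=> s0; rewrite divr_ge0 ?expR_ge0// ltW. Qed.

Lemma integral_itvy_expRN (t : R) :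
  (\int[mu]_(s in `]t, +oo[) (expR (- s))%:E = (expR (- t))%:E)%E.
Proof.
have := @integral_itvy_expRMN R 1 t ltr01; rewrite mul1r divr1 => <-.
by apply: eq_integral => s _; rewrite mul1r.
Qed.

Lemma itvy_subset (t : R) : 0 < t -> `]t, +oo[ `<=` D.
Proof. by move=> t0; apply: subset_itvr; rewrite bnd_simp ltW. Qed.

(** The definition takes the [fine] part of an extended real; for [t > 0] nothing
    is lost, because the integrand is at most [exp (- s) / t] beyond [t]. *)
Lemma expint1E (t : R) : 0 < t ->
  ((E1 t)%:E = \int[mu]_(s in `]t, +oo[) (f s)%:E)%E.
Proof.
move=> t0; rewrite fineK// ge0_fin_numE; last first.
  apply: integral_ge0 => s /= /(itvy_subset t0)/itv0yP s0.
  by rewrite lee_fin expint1_integrand_ge0.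
apply: (@le_lt_trans _ _
  (\int[mu]_(s in `]t, +oo[) (t^-1%:E * (expR (- s))%:E))%E).
  apply: ge0_le_integral => //=.
  - move=> s /(itvy_subset t0)/itv0yP s0.
    by rewrite lee_fin expint1_integrand_ge0.
  - apply/measurable_EFinP.
    apply: (measurable_funS _ (itvy_subset t0)) => //.
    exact: measurable_expint1_integrand.
  - apply/measurable_EFinP/measurable_funM => //.
    exact: measurable_expRN.
  - move=> s; rewrite in_itv/= andbT => ts.
    rewrite -EFinM lee_fin mulrC ler_wpM2r ?expR_ge0//.
    by rewrite lef_pV2 ?posrE// ?(lt_trans t0)// ltW.
rewrite ge0_integralZl//.
- by rewrite integral_itvy_expRN ltry.
- by apply/measurable_EFinP; apply: measurable_expRN.
- by rewrite lee_fin invr_ge0 ltW.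
Qed.

Lemma expint1_ge0 (t : R) : 0 < t -> 0 <= E1 t.
Proof.
move=> t0; apply: Rintegral_ge0 => s /(itvy_subset t0)/itv0yP.
exact: expint1_integrand_ge0.
Qed.

Lemma measurable_expint1 : measurable_fun D E1.
Proof.
apply/measurable_EFinP.
have mf : measurable_fun D (EFin \o f).
  by apply/measurable_EFinP; apply: measurable_expint1_integrand.
have f0 s : 0 < s -> (0 <= (EFin \o f) s)%E.
  by move=> s0; rewrite lee_fin expint1_integrand_ge0.
have := measurable_fun_integral_tail mf f0.
apply: eq_measurable_fun => t; rewrite inE => /itv0yP t0.
by rewrite /= expint1E.
Qed.

Lemma integral_itv0_expRN (s : R) : 0 < s ->
  (\int[mu]_(t in `]0%R, s[) (expR (- t))%:E = (1 - expR (- s))%:E)%E.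
Proof.
move=> s0.
rewrite -(integral_itv_bndoo true false); last first.
  by apply/measurable_EFinP; apply: measurable_expRN.
have := @integral_itv_expRMN R 1 0 s (oner_neq0 _) s0.
rewrite mulr0 oppr0 expR0 mul1r divr1 => <-.
by apply: eq_integral => t _; rewrite mul1r.
Qed.

(** After the exchange, the inner integral [1 - exp (- s)] makes the integrand
    [(exp (- s) - exp (- 2 s)) / s]. *)
Lemma integral_expRN_expint1 :
  (\int[mu]_(t in D) (expR (- t) * E1 t)%:E = (ln 2)%:E)%E.
Proof.
transitivity (\int[mu]_(t in D)
    ((expR (- t))%:E * \int[mu]_(s in `]t, +oo[) (f s)%:E))%E.
  apply: eq_integral => t; rewrite inE => /itv0yP t0.
  by rewrite -expint1E.
rewrite (@integral_triangle_exchange _ _ (EFin \o f) (EFin \o (fun t => expR (- t))))/=.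
- have := @frullani_expR R 1 2 ltr01 (ltr1n _ 2).
  rewrite ln1 subr0 => <-; apply: eq_integral => s.
  rewrite inE => /itv0yP s0.
  rewrite integral_itv0_expRN// -EFinM; congr EFin.
  rewrite (_ : - (2 * s) = - s + - s); last by ring.
  by rewrite expRD mul1r; field; rewrite gt_eqF.
- by apply/measurable_EFinP; apply: measurable_expint1_integrand.
- by apply/measurable_EFinP; apply: measurable_expRN.
- by move=> s s0; rewrite lee_fin expint1_integrand_ge0.
- by move=> s _; rewrite lee_fin expR_ge0.
Qed.

Lemma expint1B (t a : R) : 0 < t -> t < a ->
  ((E1 t - E1 a)%:E = \int[mu]_(s in `]t, a[) (f s)%:E)%E.
Proof.
move=> t0 ta; have a0 := lt_trans t0 ta.
have mf (A : set R) : A `<=` D -> measurable_fun A (EFin \o f).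
  move=> AD; apply/measurable_EFinP.
  by apply: measurable_funS measurable_expint1_integrand.
have taD : `]t, a[ `<=` D.
  by apply: subset_trans (itvy_subset t0); apply: subset_itvl.
rewrite EFinB (expint1E t0) (expint1E a0).
have -> : `]t, +oo[%classic = `]t, a] `|` `]a, +oo[ :> set R.
  by rewrite -itv_bndbnd_setU// bnd_simp ltW.
rewrite ge0_integral_setU//=.
- rewrite -expint1E// addeK//.
  by rewrite -integral_itv_bndo_bndc//; exact: mf.
- by rewrite -itv_bndbnd_setU ?bnd_simp//; [apply: mf; exact: itvy_subset|exact: ltW].
- move=> s; rewrite !in_itv/= andbT => sta; rewrite lee_fin.
  apply: expint1_integrand_ge0; case: sta => [/andP[ts _]|sa];
  [exact: lt_trans t0 ts|exact: lt_trans a0 sa].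
- apply/disj_setPS => s [/=]; rewrite !in_itv/= andbT => /andP[_ sa].
  by rewrite ltNge sa.
Qed.

(** The square is the integral of [f s * f a] over the quadrant [s, a > t], which
    the diagonal cuts into two triangles of equal integral.  In one variable:
    [E t = E s + (E t - E s)] under the integral of [f s], and the exchange shows
    that both terms contribute the same. *)
Lemma sqr_expint1 (t : R) : 0 < t ->
  (((E1 t) ^+ 2)%:E = 2%:E * \int[mu]_(s in `]t, +oo[) (f s * E1 s)%:E)%E.
Proof.
move=> t0.
have mf : measurable_fun `]t, +oo[ f.
  by apply: measurable_funS measurable_expint1_integrand => //; exact: itvy_subset.
have mE : measurable_fun `]t, +oo[ E1.
  by apply: measurable_funS measurable_expint1 => //; exact: itvy_subset.
have f0 s : t < s -> 0 <= f s.
  by move=> ts; rewrite expint1_integrand_ge0// (lt_trans t0).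
have E0 s : t < s -> 0 <= E1 s.
  by move=> ts; rewrite expint1_ge0// (lt_trans t0).
have swap : (\int[mu]_(s in `]t, +oo[) (f s * E1 s)%:E =
    \int[mu]_(s in `]t, +oo[) (f s * (E1 t - E1 s))%:E)%E.
  transitivity (\int[mu]_(s in `]t, +oo[)
      ((f s)%:E * \int[mu]_(a in `]s, +oo[) (f a)%:E))%E.
    apply: eq_integral => s; rewrite inE/= in_itv/= andbT => ts.
    by rewrite -expint1E ?(lt_trans t0).
  rewrite (@integral_triangle_exchange _ _ (EFin \o f) (EFin \o f))/=.
  - apply: eq_integral => s; rewrite inE/= in_itv/= andbT => ts.
    by rewrite -expint1B.
  - exact/measurable_EFinP.
  - exact/measurable_EFinP.
  - by move=> s ts; rewrite lee_fin f0.
  - by move=> s ts; rewrite lee_fin f0.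
have EB s : t < s -> 0 <= E1 t - E1 s.
  move=> ts; rewrite -lee_fin expint1B//; apply: integral_ge0 => a /=.
  by rewrite in_itv/= => /andP[ta _]; rewrite lee_fin f0.
transitivity (\int[mu]_(s in `]t, +oo[)
    ((f s * E1 s)%:E + (f s * (E1 t - E1 s))%:E))%E.
  (* One factor is written as the integral of [f]; the other one is a constant
     moved under that integral. *)
  rewrite expr2 EFinM {2}expint1E// -ge0_integralZl//.
  - by apply: eq_integral => s _; rewrite -EFinD -EFinM; congr EFin; ring.
  - exact/measurable_EFinP.
  - by move=> s; rewrite /= in_itv/= andbT => ts; rewrite lee_fin f0.
  - by rewrite lee_fin expint1_ge0.
rewrite ge0_integralD//.
- by rewrite -swap -[(2)%:E]/((1 + 1)%:E) EFinD ge0_muleDl ?mul1e.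
- move=> s; rewrite /= in_itv/= andbT => ts.
  by rewrite lee_fin mulr_ge0 ?f0 ?E0.
- exact/measurable_EFinP/measurable_funM.
- move=> s; rewrite /= in_itv/= andbT => ts.
  by rewrite lee_fin mulr_ge0 ?f0 ?EB.
- by apply/measurable_EFinP/measurable_funM => //; apply: measurable_funB.
Qed.

(** Substituting [sqr_expint1] and exchanging leaves the weight
    [f s * (1 - exp (- s))], which is at most [exp (- s)]: the singularity of
    [f] at [0] cancels and the integral of [integral_expRN_expint1] reappears. *)
Lemma integral_expRN_sqr_expint1 :
  (\int[mu]_(t in D) (expR (- t) * (E1 t) ^+ 2)%:E <= (2 * ln 2)%:E)%E.
Proof.
have mfE : measurable_fun D (EFin \o (fun s => f s * E1 s)).
  apply/measurable_EFinP/measurable_funM.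
    exact: measurable_expint1_integrand.
  exact: measurable_expint1.
have fE0 s : 0 < s -> 0 <= f s * E1 s.
  by move=> s0; rewrite mulr_ge0 ?expint1_integrand_ge0 ?expint1_ge0.
have mtail := measurable_fun_integral_tail mfE (fun s s0 => fE0 s s0).
have -> : (\int[mu]_(t in D) (expR (- t) * (E1 t) ^+ 2)%:E =
    2%:E * \int[mu]_(t in D) ((expR (- t))%:E *
      \int[mu]_(s in `]t, +oo[) (f s * E1 s)%:E))%E.
  rewrite -ge0_integralZl//.
  - apply: eq_integral => t; rewrite inE => /itv0yP t0.
    by rewrite EFinM sqr_expint1// muleCA.
  - apply: emeasurable_funM => //.
    by apply/measurable_EFinP; apply: measurable_expRN.
  - move=> t /itv0yP t0; rewrite mule_ge0 ?lee_fin ?expR_ge0//.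
    apply: integral_ge0 => s /(itvy_subset t0)/itv0yP s0.
    by rewrite lee_fin fE0.
rewrite EFinM lee_pmul2l//.
rewrite (@integral_triangle_exchange _ _ _ (EFin \o (fun t => expR (- t))))//=.
- rewrite -integral_expRN_expint1.
  apply: ge0_le_integral => //=.
  + move=> s /itv0yP s0; rewrite mule_ge0 ?lee_fin ?fE0//.
    by apply: integral_ge0 => t _; rewrite lee_fin expR_ge0.
  + apply: (@eq_measurable_fun _ _ _ _ D
      (EFin \o (fun s : R => f s * E1 s * (1 - expR (- s))))).
      move=> s; rewrite inE => /itv0yP s0.
      by rewrite integral_itv0_expRN.
    apply/measurable_EFinP/measurable_funM; first exact/measurable_EFinP.
    by apply: measurable_funB => //; exact: measurable_expRN.
  + apply/measurable_EFinP/measurable_funM; first exact: measurable_expRN.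
    exact: measurable_expint1.
  + move=> s /itv0yP s0; rewrite integral_itv0_expRN// -EFinM lee_fin.
    rewrite mulrAC ler_wpM2r ?expint1_ge0//.
    rewrite -mulrA ler_piMr ?expR_ge0// mulrC ler_pdivrMr// mul1r.
    by have := expR_ge1Dx (- s); lra.
- by apply/measurable_EFinP; apply: measurable_expRN.
Qed.

End expint1.

(** * The expansion *)

Lemma ge0_integrable_EFin d (T : measurableType d) (R : realType)
    (mu : {measure set T -> \bar R}) (D : set T) (f : T -> R) :
  measurable D -> measurable_fun D f -> (forall x, D x -> 0 <= f x) ->
  (\int[mu]_(x in D) (f x)%:E < +oo)%E -> mu.-integrable D (EFin \o f).
Proof.
move=> mD mf f0 foo; apply/integrableP; split; first exact/measurable_EFinP.
rewrite (eq_integral (EFin \o f))// => x; rewrite inE => Dx.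
by rewrite gee0_abs// lee_fin f0.
Qed.

(** From [exp (- y) <= 1 / (1 + y)] and
    [(1 + y) * (1 - y + y ^ 2) = 1 + y ^ 3 >= 1]. *)
Lemma expRN_le_quadratic (R : realType) (y : R) : 0 <= y ->
  expR (- y) <= 1 - y + y ^+ 2.
Proof.
move=> y0; rewrite expRN invf_ple ?posrE ?expR_gt0//; last by nra.
apply: le_trans (expR_ge1Dx y).
rewrite -[leLHS]mul1r ler_pdivrMr; last by nra.
by have := exprn_ge0 3 y0; lra.
Qed.

Section golomb_dickman.
Variable R : realType.
Local Notation mu := (@lebesgue_measure R).
Local Notation E1 := (@expint1 R).
Local Notation D := (`]0%R, +oo[%classic : set R).

Let e0 (t : R) := expR (- t).
Let e1 (t : R) := expR (- t) * E1 t.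
Let e2 (t : R) := expR (- t) * E1 t ^+ 2.

Let me0 : measurable_fun D e0.
Proof. exact: measurable_expRN. Qed.

Let me1 : measurable_fun D e1.
Proof. by apply: measurable_funM => //; exact: measurable_expint1. Qed.

Let me2 : measurable_fun D e2.
Proof.
by apply: measurable_funM => //; apply: measurable_funX; exact: measurable_expint1.
Qed.

Let integral_e0 : (\int[mu]_(t in D) (e0 t)%:E = 1%:E)%E.
Proof. by rewrite integral_itvy_expRN oppr0 expR0. Qed.

Let ie0 : mu.-integrable D (EFin \o e0).
Proof.
apply: ge0_integrable_EFin => //; first by move=> t _; exact: expR_ge0.
by rewrite integral_e0 ltry.
Qed.

Let ie1 : mu.-integrable D (EFin \o e1).
Proof.
apply: ge0_integrable_EFin => //.
  by move=> t /itv0yP t0; rewrite mulr_ge0 ?expR_ge0 ?expint1_ge0.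
by rewrite integral_expRN_expint1 ltry.
Qed.

Let ie2 : mu.-integrable D (EFin \o e2).
Proof.
apply: ge0_integrable_EFin => //.
  by move=> t _; rewrite mulr_ge0 ?expR_ge0 ?sqr_ge0.
by rewrite (le_lt_trans (integral_expRN_sqr_expint1 R))// ltry.
Qed.

Let Rint_e0 : \int[mu]_(t in D) e0 t = 1.
Proof. by rewrite /Rintegral integral_e0. Qed.

Let Rint_e1 : \int[mu]_(t in D) e1 t = ln 2.
Proof. by rewrite /Rintegral integral_expRN_expint1. Qed.

Let Rint_e2 : \int[mu]_(t in D) e2 t <= 2 * ln 2.
Proof.
rewrite -lee_fin fineK; first exact: integral_expRN_sqr_expint1.
exact: (integrable_fin_num _ ie2).
Qed.

(** The weight [exp (- t)] dominates the integrand, so the pointwise bounds on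
    [exp (- theta * E1 t)] can be integrated term by term. *)
Lemma golomb_dickman_expansion (theta : R) : 0 < theta ->
  `|golomb_dickman theta - (1 - ln 2 * theta)| <= 2 * ln 2 * theta ^+ 2.
Proof.
move=> th0.
have iZ (c : R) (h : R -> R) : mu.-integrable D (EFin \o h) ->
    mu.-integrable D (EFin \o (fun t => c * h t)).
  by move=> ih; exact: (@integrableZl _ _ _ mu D _ c (EFin \o h)).
have iB : mu.-integrable D (EFin \o (fun t => e0 t - theta * e1 t)).
  apply: (@integrableB _ _ _ mu D _ (EFin \o e0)
    (EFin \o (fun t => theta * e1 t))) => //; exact: iZ.
have iC : mu.-integrable D
    (EFin \o (fun t => e0 t - theta * e1 t + theta ^+ 2 * e2 t)).
  apply: (@integrableD _ _ _ mu D _ (EFin \o (fun t => e0 t - theta * e1 t))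
    (EFin \o (fun t => theta ^+ 2 * e2 t))) => //; exact: iZ.
have ig : mu.-integrable D (EFin \o (fun t => expR (- t - theta * E1 t))).
  apply: le_integrable ie0 => //.
    apply/measurable_EFinP; apply: measurableT_comp => //.
    apply: measurable_funB; first by apply: measurable_funN.
    by apply: measurable_funM => //; exact: measurable_expint1.
  move=> t /itv0yP t0; rewrite /= !ger0_norm ?expR_ge0// lee_fin ler_expR.
  by rewrite gerBl mulr_ge0 ?expint1_ge0 ?(ltW th0).
have lo : 1 - ln 2 * theta <= golomb_dickman theta.
  (* [ln 2] has to go first: the numeral [2] contains the unit that stands for
     the integral of [e0]. *)
  rewrite -Rint_e1 -Rint_e0 mulrC -RintegralZl// -RintegralB//; last exact: iZ.
  apply: le_Rintegral => // t /itv0yP t0.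
  rewrite expRD /e1 /e0 -{1}[expR (- t)]mulr1 mulrCA -mulrBr.
  by rewrite ler_wpM2l ?expR_ge0// expR_ge1Dx.
have hi : golomb_dickman theta <= 1 - ln 2 * theta + theta ^+ 2 * (2 * ln 2).
  apply: (@le_trans _ _ (1 - ln 2 * theta + theta ^+ 2 * \int[mu]_(t in D) e2 t)).
    rewrite -Rint_e1 -Rint_e0 mulrC -!RintegralZl// -RintegralB//; last exact: iZ.
    rewrite -RintegralD//; last exact: iZ.
    apply: le_Rintegral => // t /itv0yP t0.
    rewrite expRD (le_trans (ler_wpM2l (expR_ge0 _) (expRN_le_quadratic _)))//.
      by rewrite mulr_ge0 ?expint1_ge0 ?(ltW th0).
    by rewrite le_eqVlt; apply/predU1P; left; rewrite /e0 /e1 /e2; ring.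
  by rewrite lerD2l ler_wpM2l ?sqr_ge0.
by rewrite ger0_norm ?subr_ge0//; lra.
Qed.

End golomb_dickman.

Theorem proposition4p4 (R : realType) :
  (fun theta : R => golomb_dickman theta) =
    (fun theta : R => 1 - ln 2 * theta)
    +O_ (0^'+) (fun theta : R => theta ^+ 2).
Proof.
apply/eqaddOP/bigO_exP; exists (2 * ln 2).
  by rewrite mulr_gt0// ln_gt0// ltr1n.
near=> theta.
rewrite [X in _ <= _ * X]ger0_norm ?sqr_ge0//.
exact: golomb_dickman_expansion.
Unshelve. all: by end_near. Qed.
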